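(* Let $f$ be a convex, differentiable, coercive function of $m$ blocks $x=(x_1,\dots,x_m)$ with finite $\min f$, satisfying $\|\nabla_i f(x)-\nabla_i f(y)\|\le L_i\|x-y\|$ for all $x,y$ and $i\in\{1,\dots,m\}$ ($L_i>0$). For each $i$ let $(\beta_{k,i})_{k\ge0}\subseteq[0,1)$ be non-increasing with $$0<\inf_k\beta_{k,i}\le\beta_{k,i}\le\beta_0<1,$$ where $\beta_0$ is a constant, and let $\gamma_{k,i}=\frac{2(1-\beta_{k,i})c}{L_i}$ with fixed $0<c<1$. Let $(x^k)_{k\ge0}$ be generated by the cyclic coordinate descent Heavy-ball scheme. Then $$f(x^k)-\min f=O\left(\frac{4R\cdot\sup_k\{\hat\varepsilon_k\}}{k}\right)\qquad(k\to\infty),$$ where $R:=\sup_{k\ge0}\sup_{x^*\in\arg\min f}\|x^k-x^*\|^2$ and $\hat\varepsilon_k$ is defined in the context.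
   Context: $\|\cdot\|$ is the Euclidean norm; $\nabla_i f$ is the partial gradient with respect to block $x_i$. $f$ is coercive if $f(x)\to+\infty$ as $\|x\|\to+\infty$. Write $x^k=(x_1^k,\dots,x_m^k)$, $L:=\sum_{i=1}^m L_i$, $\underline L:=\min_i L_i$. The cyclic coordinate descent Heavy-ball scheme, started from arbitrary points $x^{-1},x^0$, performs for each $k\ge 0$, and for $i$ from $1$ to $m$ in order, $$x_i^{k+1}=x_i^k-\gamma_{k,i}\nabla_i^k f+\beta_{k,i}(x_i^k-x_i^{k-1}),\qquad \nabla_i^k f:=\nabla_i f(x_1^{k+1},\dots,x_{i-1}^{k+1},x_i^k,\dots,x_m^k).$$ Define $$\delta_{k,i}:=\frac{\beta_{k,i}}{2\gamma_{k,i}}+\frac12\left(\frac{1-\beta_{k,i}}{\gamma_{k,i}}-\frac{L_i}{2}\right),\qquad \hat\varepsilon_k:=\max\left\{\frac{4c\sum_{i=1}^m\left(\delta_{k,i}^2+\frac1{\gamma_{k,i}^2}\right)}{(1-c)\underline L},\ \frac{4c\,m\,L^2}{(1-c)\underline L}\right\}.$$ *)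

(* Defs.v *)
From HB Require Import structures.
From mathcomp Require Import all_boot all_order all_algebra.
From mathcomp Require Import all_classical all_reals all_analysis.

Set Implicit Arguments.
Unset Strict Implicit.
Unset Printing Implicit Defensive.

Import Order.TTheory GRing.Theory Num.Theory.
Import numFieldNormedType.Exports.

Local Open Scope classical_set_scope.
Local Open Scope ring_scope.

(* A point with m blocks, the i-th one in R^(n i), is a row vector of type
   'rV[R]_(\sum_(i < m) n i); its i-th block is submxrow x i : 'rV[R]_(n i). *)

(* The library norm `|x| on row vectors is the sup norm. *)
Definition enorm (R : realType) (n : nat) (x : 'rV[R]_n) : R :=
  Num.sqrt (\sum_(j < n) x 0 j ^+ 2).

Definition grad (R : realType) (n : nat) (f : 'rV[R]_n -> R) (x : 'rV[R]_n) :
    'rV[R]_n :=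
  \row_(j < n) 'D_(delta_mx 0 j) f x.

Definition pgrad (R : realType) (m : nat) (n : 'I_m -> nat)
    (f : 'rV[R]_(\sum_(i < m) n i) -> R) (i : 'I_m)
    (x : 'rV[R]_(\sum_(i < m) n i)) : 'rV[R]_(n i) :=
  submxrow (grad f x) i.

Definition coercive (R : realType) (n : nat) (f : 'rV[R]_n -> R) : Prop :=
  forall A : R, exists r : R, forall x : 'rV[R]_n, r < enorm x -> A < f x.

Definition argmin (T : Type) (R : realType) (f : T -> R) : set T :=
  [set x | forall y, f x <= f y].

Definition is_min (T : Type) (R : realType) (f : T -> R) (v : R) : Prop :=
  exists2 x, argmin f x & f x = v.

(* (x_1^{k+1}, ..., x_{i-1}^{k+1}, x_i^k, ..., x_m^k) *)
Definition ccd_point (R : realType) (m : nat) (n : 'I_m -> nat)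
    (x : nat -> 'rV[R]_(\sum_(i < m) n i)) (k : nat) (i : 'I_m) :
    'rV[R]_(\sum_(i < m) n i) :=
  \mxrow_(j < m) (if (j < i)%N then submxrow (x k.+1) j else submxrow (x k) j).

(* The iterates are x^k = x k for k >= 0, and x^{-1} = xm1; prev xm1 x k is
   x^{k-1}. *)
Definition prev (T : Type) (xm1 : T) (x : nat -> T) (k : nat) : T :=
  if k is k'.+1 then x k' else xm1.

Definition ccd_heavy_ball (R : realType) (m : nat) (n : 'I_m -> nat)
    (f : 'rV[R]_(\sum_(i < m) n i) -> R) (gamma beta : nat -> 'I_m -> R)
    (xm1 : 'rV[R]_(\sum_(i < m) n i))
    (x : nat -> 'rV[R]_(\sum_(i < m) n i)) : Prop :=
  forall (k : nat) (i : 'I_m),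
    submxrow (x k.+1) i =
      submxrow (x k) i - gamma k i *: pgrad f i (ccd_point x k i)
      + beta k i *: (submxrow (x k) i - submxrow (prev xm1 x k) i).

Definition delta (R : realType) (m : nat) (L : 'I_m -> R)
    (gamma beta : nat -> 'I_m -> R) (k : nat) (i : 'I_m) : R :=
  beta k i / (2 * gamma k i)
  + 1 / 2 * ((1 - beta k i) / gamma k i - L i / 2).

Definition Lsum (R : realType) (m : nat) (L : 'I_m -> R) : R :=
  \sum_(i < m) L i.

Definition Lmin (R : realType) (m : nat) (L : 'I_m.+1 -> R) : R :=
  \big[Num.min/L ord0]_(i < m.+1) L i.

(* The number of blocks is m.+1 here. *)
Definition eps_hat (R : realType) (m : nat) (L : 'I_m.+1 -> R) (c : R)
    (gamma beta : nat -> 'I_m.+1 -> R) (k : nat) : R :=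
  Num.max
    (4 * c * (\sum_(i < m.+1) (delta L gamma beta k i ^+ 2
                               + 1 / gamma k i ^+ 2))
       / ((1 - c) * Lmin L))
    (4 * c * m.+1%:R * Lsum L ^+ 2 / ((1 - c) * Lmin L)).

Definition Rsup (R : realType) (n : nat) (f : 'rV[R]_n -> R)
    (x : nat -> 'rV[R]_n) : R :=
  sup (range (fun k : nat =>
    sup [set enorm (x k - xs) ^+ 2 | xs in argmin f])).

(* Main.v *)
Require Import Defs.
From HB Require Import structures.
From mathcomp Require Import all_boot all_order all_algebra.
From mathcomp Require Import all_classical all_reals all_analysis.
From mathcomp Require Import ring lra.

Set Implicit Arguments.
Unset Strict Implicit.
Unset Printing Implicit Defensive.

Import Order.TTheory GRing.Theory Num.Theory.
Import numFieldNormedType.Exports.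

Local Open Scope classical_set_scope.
Local Open Scope ring_scope.

(** Write D_k for x^k - x^{k-1}. The objective itself need not decrease along a
heavy-ball iteration, because the inertial term can push uphill; what decreases
is the Lyapunov sequence
  xi_k = f(x^k) + sum_i delta_{k,i} |block i of D_k|^2.
Applying the descent lemma to one block after the other along a sweep and
substituting the update rule for the partial gradients shows that a sweep
lowers xi by at least kappa_min (|D_k|^2 + |D_{k+1}|^2) ([lyapunov_step]). The
weights delta_{k,i} were chosen to split the available decrease evenly between
D_k and D_{k+1}, and they can be carried from one sweep to the next because
they are non-increasing in k, as the beta_{k,i} are.

Monotonicity of xi and coercivity confine all iterates and all minimizers to one
ball. By convexity, the gap f(x^{k+1}) - f(y) to a minimizer y is at most the
scalar product of the gradient at x^{k+1} with x^{k+1} - y. Up to a Lipschitz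
error of order |D_{k+1}|, the blocks of that gradient are the partial gradients
used by the sweep, which are linear in D_k and D_{k+1}. Hence phi_k = xi_k - min
f satisfies phi_{k+1} <= C (|D_k| + |D_{k+1}|) ([lyapunov_gap_le]); squaring and
comparing with the decrease gives phi_{k+1}^2 <= C' (phi_k - phi_{k+1}), and
this recursion forces phi_k = O(1/k) ([sublinear_rate]).

An asymptotic bound absorbs any positive constant, so it remains to see that
R and sup_k eps_hat_k are finite, as a supremum over an unbounded set would be
read as 0, and that the right-hand side vanishes only when the left-hand side
does. The sequence eps_hat_k is positive and maximal at k = 0
([eps_hat_le0]), the boundedness of the iterates makes R finite, and R = 0
means that every iterate is a minimizer. *)

(** * Euclidean scalar product and its blocks *)

Section dot.
Variable R : realType.

Definition dot (n : nat) (u v : 'rV[R]_n) : R := \sum_(j < n) u 0 j * v 0 j.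

Lemma dotDl n (u v w : 'rV[R]_n) : dot (u + v) w = dot u w + dot v w.
Proof.
by rewrite /dot -big_split /=; apply: eq_bigr => j _; rewrite mxE mulrDl.
Qed.

Lemma dotC n (u v : 'rV[R]_n) : dot u v = dot v u.
Proof. by apply: eq_bigr => j _; rewrite mulrC. Qed.

Lemma dotZl n (a : R) (u v : 'rV[R]_n) : dot (a *: u) v = a * dot u v.
Proof. by rewrite /dot mulr_sumr; apply: eq_bigr => j _; rewrite mxE mulrA. Qed.

Lemma dotDr n (u v w : 'rV[R]_n) : dot w (u + v) = dot w u + dot w v.
Proof. by rewrite !(dotC w) dotDl. Qed.

Lemma dotZr n (a : R) (u v : 'rV[R]_n) : dot u (a *: v) = a * dot u v.
Proof. by rewrite !(dotC u) dotZl. Qed.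

Lemma dotNl n (u v : 'rV[R]_n) : dot (- u) v = - dot u v.
Proof. by rewrite -scaleN1r dotZl mulN1r. Qed.

Lemma dotNr n (u v : 'rV[R]_n) : dot u (- v) = - dot u v.
Proof. by rewrite !(dotC u) dotNl. Qed.

Lemma dot0r n (u : 'rV[R]_n) : dot u 0 = 0.
Proof. by rewrite /dot big1 // => j _; rewrite mxE mulr0. Qed.

Lemma dot_ge0 n (u : 'rV[R]_n) : 0 <= dot u u.
Proof. by apply: sumr_ge0 => j _; rewrite -expr2 sqr_ge0. Qed.

Lemma enorm_ge0 n (u : 'rV[R]_n) : 0 <= enorm u.
Proof. exact: sqrtr_ge0. Qed.

Lemma sqr_enorm n (u : 'rV[R]_n) : enorm u ^+ 2 = dot u u.
Proof.
rewrite /enorm sqr_sqrtr; first by apply: eq_bigr => j _; rewrite expr2.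
by apply: sumr_ge0 => j _; exact: sqr_ge0.
Qed.

Lemma enorm_eq0 n (u : 'rV[R]_n) : enorm u = 0 -> u = 0.
Proof.
move=> u0; have := sqr_enorm u; rewrite u0 expr0n /= => /esym/eqP.
rewrite /dot psumr_eq0 => [/allP uj0|j _]; last by rewrite -expr2 sqr_ge0.
apply/rowP => j; rewrite mxE; apply/eqP.
by have := uj0 j (mem_index_enum j); rewrite mulf_eq0 orbb.
Qed.

Lemma dot_le_enorm n (u v : 'rV[R]_n) : dot u v <= enorm u * enorm v.
Proof.
have [u0|u_neq0] := eqVneq (enorm u) 0.
  by rewrite u0 mul0r (enorm_eq0 u0) dotC dot0r.
have [v0|v_neq0] := eqVneq (enorm v) 0.
  by rewrite v0 mulr0 (enorm_eq0 v0) dot0r.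
have uv_gt0 : 0 < enorm u * enorm v.
  by rewrite mulr_gt0 // lt0r ?u_neq0 ?v_neq0 enorm_ge0.
(* The squared norm of this vector is 2 |u| |v| (|u| |v| - <u, v>). *)
have := dot_ge0 (enorm v *: u - enorm u *: v).
rewrite !(dotDl, dotDr, dotNl, dotNr, dotZl, dotZr) -!sqr_enorm (dotC v u).
move=> H; rewrite -(ler_pM2l uv_gt0); nra.
Qed.

Lemma ler_enormD n (u v : 'rV[R]_n) : enorm (u + v) <= enorm u + enorm v.
Proof.
rewrite -(@ler_pXn2r _ 2) ?nnegrE ?addr_ge0 ?enorm_ge0 //.
rewrite sqr_enorm !(dotDl, dotDr) (dotC v u) -!sqr_enorm.
have := dot_le_enorm u v; nra.
Qed.

Lemma enormZ n (a : R) (u : 'rV[R]_n) : enorm (a *: u) = `|a| * enorm u.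
Proof.
apply: (@pexpIrn _ 2) => //; rewrite ?nnegrE ?mulr_ge0 ?enorm_ge0 //.
by rewrite exprMn !sqr_enorm dotZl dotZr real_normK ?num_real // mulrA expr2.
Qed.

Lemma enormN n (u : 'rV[R]_n) : enorm (- u) = enorm u.
Proof. by rewrite -scaleN1r enormZ normrN1 mul1r. Qed.

Lemma ler_enormB n (u v : 'rV[R]_n) : enorm (u - v) <= enorm u + enorm v.
Proof. by rewrite -(enormN v) ler_enormD. Qed.

End dot.

Section blocks.
Variables (R : realType) (m : nat) (n : 'I_m -> nat).
Implicit Types u v : 'rV[R]_(\sum_(i < m) n i).

Lemma dot_blocks u v :
  dot u v = \sum_(i < m) dot (submxrow u i) (submxrow v i).
Proof.
rewrite -[u in LHS]submxrowK -[v in LHS]submxrowK /dot.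
rewrite [RHS]sig_big_dep /= (reindex _ tagnat.sig_bij_on) /=.
by apply: eq_bigr => l _; rewrite !mxE.
Qed.

Lemma enorm_block u (i : 'I_m) : enorm (submxrow u i) <= enorm u.
Proof.
rewrite -(@ler_pXn2r _ 2) ?nnegrE ?enorm_ge0 //.
rewrite !sqr_enorm (dot_blocks u) (bigD1 i) //= lerDl.
by apply: sumr_ge0 => j _; exact: dot_ge0.
Qed.

End blocks.

(** * First-order inequalities *)

Section calculus.
Variables (R : realType) (n : nat) (f : 'rV[R]_n -> R).

Lemma derive_grad p v :
  differentiable f p -> 'D_v f p = dot (grad f p) v.
Proof.
move=> df; rewrite {1}(row_sum_delta v) deriveE // linear_sum /=.
apply: eq_bigr => j _.
by rewrite linearZ /= mxE deriveE // mulrC.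
Qed.

Lemma is_derive_line p d (t : R) :
  differentiable f (p + t *: d) ->
  is_derive t 1 (fun s : R => f (p + s *: d)) (dot (grad f (p + t *: d)) d).
Proof.
move=> df.
(* The difference quotient of the line restriction is that of f along d. *)
have E : (fun h : R => h^-1 *: (((fun s : R => f (p + s *: d)) \o shift t)
                                  (h *: (1 : R)) - f (p + t *: d)))
  = (fun h : R => h^-1 *: ((f \o shift (p + t *: d)) (h *: d)
                           - f (p + t *: d))).
  apply/funext => h /=; congr (_ *: (f _ - _)).
  by rewrite [h *: 1]mulr1 scalerDl addrCA.
have := @diff_derivable _ _ _ f _ d df.
rewrite -derive_grad // /derivable /derive -E.
by move=> dl; apply: DeriveDef.
Qed.

(** The hypothesis bounds the derivative of t |-> f (p + t d) by its value at 0
plus K t; the conclusion is the integral of that bound over [0, 1], obtained by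
the mean value theorem for the difference with the quadratic majorant. *)
Lemma quadratic_upper_bound p d (K : R) :
  (forall q, differentiable f q) ->
  (forall t, 0 <= t -> dot (grad f (p + t *: d) - grad f p) d <= K * t) ->
  f (p + d) <= f p + dot (grad f p) d + K / 2.
Proof.
move=> df Kd.
pose h (s : R) : R := f (p + s *: d) - (dot (grad f p) d * s + K / 2 * s ^+ 2).
have hd (s : R) : is_derive s 1 h
    (dot (grad f (p + s *: d)) d - (dot (grad f p) d + K * s)).
  have ? := @is_derive_line p d s (df _).
  apply: is_derive_eq.
  by rewrite /GRing.scale /=; field.
have [|s s01] := @MVT_segment R h
    (fun s => dot (grad f (p + s *: d)) d - (dot (grad f p) d + K * s))
    0 1 ler01 (fun s _ => hd s).
  apply: continuous_subspaceT => s.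
  by apply: differentiable_continuous; apply/derivable1_diffP; case: (hd s).
have s0 : 0 <= s by move: s01; rewrite in_itv /= => /andP[].
have := Kd s s0; rewrite dotDl dotNl /h scale1r scale0r addr0; lra.
Qed.

(** By convexity the difference quotients of f at p towards q, with step in
]0, 1], are at most f q - f p; the directional derivative is their limit from
the right. *)
Lemma convex_grad p q :
  convex_function setT f -> differentiable f p ->
  f p + dot (grad f p) (q - p) <= f q.
Proof.
move=> cf df; rewrite addrC -lerBrDr -derive_grad //.
have dfv := @diff_derivable _ _ _ f _ (q - p) df.
rewrite /derive cvg_at_rightE; last exact: dfv.
apply: limr_le.
  rewrite -(cvg_at_rightE
    (fun h : R => h^-1 *: ((f \o shift p) (h *: (q - p)) - f p))) //.
  apply: cvg_trans dfv; apply: cvg_app.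
  move=> A [e egt0 Ae]; exists e => // x xe xgt0; apply: Ae => //.
  exact/lt0r_neq0.
near=> h.
have h0 : 0 < h by near: h; exact: nbhs_right_gt.
have h1 : h <= 1 by near: h; apply: nbhs_right_le.
rewrite /= /GRing.scale /= ler_pdivrMl // lerBlDr.
have := cf (Itv01 (ltW h0) h1) q p; rewrite !inE => /(_ I I).
rewrite convRE /= /conv /=.
have -> : h *: q + (1 - h) *: p = h *: (q - p) + p.
  by rewrite scalerBr scalerBl scale1r -addrA (addrC (- _)).
move=> H; apply: le_trans H _; rewrite [(1 - h) * _]mulrBl; nra.
Unshelve. all: by end_near. Qed.

End calculus.

(** * A recursion with a sublinear rate *)

(** If phi_{k+1} exceeded B / (k + 2), the recursion would give
phi_k >= phi_{k+1} + phi_{k+1}^2 / C > B / (k + 1) as soon as B >= 2 C. *)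
Lemma sublinear_rate (R : realType) (phi : nat -> R) (C : R) :
  0 < C -> (forall k, 0 <= phi k) ->
  (forall k, phi k.+1 ^+ 2 <= C * (phi k - phi k.+1)) ->
  exists2 B : R, 0 < B & forall k, phi k <= B / k.+1%:R.
Proof.
move=> C_gt0 phi_ge0 rec; exists (phi 0%N + 2 * C) => [|k].
  by rewrite ltr_wpDl // mulr_gt0.
set B := phi 0%N + 2 * C.
have B_ge : 2 * C <= B by rewrite lerDr.
elim: k => [|k IHk]; first by rewrite divr1 lerDl mulr_ge0 // ltW.
rewrite leNgt; apply/negP => Bphi.
have k1 : 1 <= k.+1%:R :> R by rewrite ler1n.
set t : R := k.+1%:R in k1 IHk.
have kE : k.+2%:R = t + 1 :> R by rewrite -natr1.
have t_gt0 : 0 < t by lra.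
rewrite kE ltr_pdivrMr in Bphi; last lra.
rewrite ler_pdivlMr // in IHk.
have := rec k; have := phi_ge0 k.+1; have := phi_ge0 k.
set a := phi k in IHk *; set b := phi k.+1 in Bphi * => a0 b0 ab.
have b_gt0 : 0 < b by rewrite -(pmulr_lgt0 _ (_ : 0 < t + 1)); lra.
(* Here a and b are phi_k and phi_{k+1}, with a t <= B and b (t + 1) > B. The
   steps below divide the recursion by b, which contradicts 2 C <= B. *)
have H1 : B * b < b ^+ 2 * (t + 1) by nra.
have H2 : B * b < C * (a - b) * (t + 1) by nra.
have H3 : C * (a * t) <= C * B by rewrite ler_pM2l.
have H4 : B * b * t < C * (B - b * t) * (t + 1) by nra.
have H5 : B * b * t < C * b * (t + 1) by nra.
have H6 : B * t < C * (t + 1) by nra.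
nra.
Qed.

(** * Descent along one sweep *)

Section block_step.
Variables (R : realType) (m : nat) (n : 'I_m -> nat).
Variables (f : 'rV[R]_(\sum_(i < m) n i) -> R).
Implicit Types p q : 'rV[R]_(\sum_(i < m) n i).

(** When q - p is supported in block i, only the Lipschitz constant of the
i-th partial gradient enters the quadratic term of the descent lemma. *)
Lemma block_descent (l : R) (i : 'I_m) p q :
  (forall y, differentiable f y) ->
  (forall y z, enorm (pgrad f i y - pgrad f i z) <= l * enorm (y - z)) ->
  (forall j, j != i -> submxrow p j = submxrow q j) ->
  f q <= f p + dot (pgrad f i p) (submxrow (q - p) i)
         + l / 2 * enorm (submxrow (q - p) i) ^+ 2.
Proof.
move=> df lip pq.
have dotE w : dot w (q - p) = dot (submxrow w i) (submxrow (q - p) i).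
  rewrite dot_blocks (bigD1 i) //= [X in _ + X]big1; first exact: addr0.
  by move=> j /pq pqj; rewrite submxrowB pqj subrr dot0r.
have normE : enorm (q - p) = enorm (submxrow (q - p) i).
  by apply: (@pexpIrn _ 2) => //; rewrite ?nnegrE ?enorm_ge0 // !sqr_enorm dotE.
have := @quadratic_upper_bound _ _ f p (q - p) (l * enorm (q - p) ^+ 2) df.
rewrite (addrC p) subrK dotE -normE mulrAC; apply=> t t_ge0.
rewrite dotE submxrowB; apply: le_trans (dot_le_enorm _ _) _.
have := lip (p + t *: (q - p)) p.
rewrite (addrC p) addrK enormZ ger0_norm // -normE /pgrad.
have := enorm_ge0 (q - p); nra.
Qed.

End block_step.

Section scheme.
Variables (R : realType) (m : nat) (n : 'I_m -> nat).
Variables (f : 'rV[R]_(\sum_(i < m) n i) -> R).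
Variables (L : 'I_m -> R).
Variables (x : nat -> 'rV[R]_(\sum_(i < m) n i)).
Hypothesis f_diff : forall y, differentiable f y.
Hypothesis f_lip : forall i y z,
  enorm (pgrad f i y - pgrad f i z) <= L i * enorm (y - z).

(** A sweep passes from x^k to x^{k+1} by changing one block at a time, and the
point reached before block i is the one where the scheme evaluates the i-th
partial gradient; the block decreases telescope. *)
Lemma sweep_descent k :
  f (x k.+1) <= f (x k) + \sum_(i < m)
    (dot (pgrad f i (ccd_point x k i)) (submxrow (x k.+1 - x k) i)
     + L i / 2 * enorm (submxrow (x k.+1 - x k) i) ^+ 2).
Proof.
(* P j has its first j blocks updated. *)
pose P (j : nat) : 'rV[R]_(\sum_(i < m) n i) := \mxrow_(i < m)
  (if (i < j)%N then submxrow (x k.+1) i else submxrow (x k) i).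
have P0 : P 0%N = x k by rewrite -[RHS]submxrowK; apply: eq_mxrow.
have Pm : P m = x k.+1.
  by rewrite -[RHS]submxrowK; apply: eq_mxrow => i; rewrite ltn_ord.
rewrite addrC -lerBlDr -{1}Pm -{1}P0 -(telescope_sumr (f \o P)) // big_mkord.
apply: ler_sum => i _ /=; rewrite lerBlDr addrC addrA.
have -> : submxrow (x k.+1 - x k) i = submxrow (P i.+1 - P i) i.
  by rewrite !submxrowB !mxrowK ltnSn ltnn.
apply: block_descent => // j ji.
by rewrite !mxrowK ltnS [(j <= i)%N]leq_eqVlt (negbTE (ji : val j != val i)).
Qed.

Lemma ccd_point_dist k i :
  enorm (x k.+1 - ccd_point x k i) <= enorm (x k.+1 - x k).
Proof.
rewrite -(@ler_pXn2r _ 2) ?nnegrE ?enorm_ge0 // !sqr_enorm !dot_blocks.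
apply: ler_sum => j _; rewrite !submxrowB mxrowK.
by case: ifP => // _; rewrite subrr dot0r dot_ge0.
Qed.

End scheme.

(** * The Lyapunov sequence of the heavy-ball scheme *)

Section heavy_ball.
Variables (R : realType) (m : nat) (n : 'I_m.+1 -> nat).
Variables (f : 'rV[R]_(\sum_(i < m.+1) n i) -> R).
Variables (L : 'I_m.+1 -> R) (c : R) (beta gamma : nat -> 'I_m.+1 -> R).
Variables (xm1 : 'rV[R]_(\sum_(i < m.+1) n i)).
Variables (x : nat -> 'rV[R]_(\sum_(i < m.+1) n i)).
Hypothesis L_gt0 : forall i, 0 < L i.
Hypothesis beta_itv : forall k i, 0 <= beta k i < 1.
Hypothesis beta_nincr : forall i, nonincreasing_seq (beta ^~ i).
Hypothesis c_itv : 0 < c < 1.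
Hypothesis gammaE : forall k i, gamma k i = 2 * (1 - beta k i) * c / L i.

Lemma gamma_gt0 k i : 0 < gamma k i.
Proof.
have /andP[c0 _] := c_itv; have /andP[_ b1] := beta_itv k i.
by rewrite gammaE divr_gt0 // mulr_gt0 // mulr_gt0 // subr_gt0.
Qed.

Lemma gammaV_nincr k l i : (k <= l)%N -> (gamma l i)^-1 <= (gamma k i)^-1.
Proof.
move=> kl; rewrite lef_pV2 ?posrE ?gamma_gt0 // !gammaE.
have /andP[c0 _] := c_itv; rewrite ler_pM2r ?invr_gt0 // ler_pM2r //.
have := beta_nincr i kl; lra.
Qed.

Lemma gammaV_beta k i : (1 - beta k i) / gamma k i = L i / (2 * c).
Proof.
have /andP[c0 _] := c_itv; have /andP[_ b1] := beta_itv k i.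
have := L_gt0 i; rewrite gammaE => L0; field.
by rewrite !gt_eqF //; lra.
Qed.

Lemma deltaE k i : delta L gamma beta k i = (gamma k i)^-1 / 2 - L i / 4.
Proof.
have g0 := gamma_gt0 k i; rewrite /delta; field; lra.
Qed.

(** Half of (1 - beta_{k,i}) / gamma_{k,i} - L_i / 2, which the step sizes make
independent of k and which is the decrease available per unit of squared
increment: D_k and D_{k+1} get equal shares of it. *)
Definition kappa i : R := L i * (1 - c) / (4 * c).

Lemma kappa_gt0 i : 0 < kappa i.
Proof.
have /andP[c0 c1] := c_itv.
by rewrite divr_gt0 ?mulr_gt0 // subr_gt0.
Qed.

Lemma delta_kappa k i :
  delta L gamma beta k i = beta k i / gamma k i / 2 + kappa i.
Proof.
rewrite deltaE /kappa; have := gammaV_beta k i; have /andP[c0 c1] := c_itv.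
rewrite mulrBl mul1r; move: (_ / gamma k i) => b /(canRL (subrK _)) ->.
by field; lra.
Qed.

Lemma delta_ge0 k i : 0 <= delta L gamma beta k i.
Proof.
have /andP[b0 _] := beta_itv k i; rewrite delta_kappa.
by rewrite addr_ge0 ?(ltW (kappa_gt0 i)) // !divr_ge0 // ltW // gamma_gt0.
Qed.

Lemma delta_nincr k l i : (k <= l)%N ->
  delta L gamma beta l i <= delta L gamma beta k i.
Proof. by move=> /(@gammaV_nincr k l i); rewrite !deltaE; lra. Qed.

Lemma Lmin_gt0 : 0 < Lmin L.
Proof. exact: lt_bigmin. Qed.

Lemma Lmin_le i : Lmin L <= L i.
Proof. exact: bigmin_le_cond. Qed.

(** The second argument of the maximum is constant in k, and the first is
built from the non-increasing nonnegative sequences delta_{k,i} and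
1 / gamma_{k,i}. *)
Lemma eps_hat_le0 k : eps_hat L c gamma beta k <= eps_hat L c gamma beta 0.
Proof.
have /andP[c0 c1] := c_itv.
rewrite /eps_hat ge_max !le_max lexx orbT andbT; apply/orP; left.
rewrite ler_pM2r ?invr_gt0 ?mulr_gt0 ?Lmin_gt0 ?subr_gt0 //.
rewrite ler_pM2l ?mulr_gt0 //; apply: ler_sum => i _.
apply: lerD.
  by rewrite ler_pXn2r ?nnegrE ?delta_ge0 // delta_nincr.
rewrite !div1r -!exprVn ler_pXn2r ?gammaV_nincr ?nnegrE ?invr_ge0 //.
  exact/ltW/gamma_gt0.
exact/ltW/gamma_gt0.
Qed.

Lemma eps_hat_gt0 k : 0 < eps_hat L c gamma beta k.
Proof.
have /andP[c0 c1] := c_itv; rewrite /eps_hat lt_max; apply/orP; right.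
have Lsum_gt0 : 0 < Lsum L.
  by rewrite /Lsum big_ord_recl ltr_pwDl // sumr_ge0 // => i _; exact: ltW.
by rewrite divr_gt0 ?mulr_gt0 ?Lmin_gt0 ?subr_gt0 ?ltr0n.
Qed.

Lemma sup_eps_hat_gt0 : 0 < sup (range (eps_hat L c gamma beta)).
Proof.
apply: lt_le_trans (eps_hat_gt0 0) _; apply: ub_le_sup; last by exists 0%N.
by exists (eps_hat L c gamma beta 0) => _ [k _ <-]; exact: eps_hat_le0.
Qed.

Hypothesis f_diff : forall y, differentiable f y.
Hypothesis f_lip : forall i y z,
  enorm (pgrad f i y - pgrad f i z) <= L i * enorm (y - z).
Hypothesis x_scheme : ccd_heavy_ball f gamma beta xm1 x.

Let D k := x k - Defs.prev xm1 x k.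

Definition lyapunov k : R := f (x k) +
  \sum_(i < m.+1) delta L gamma beta k i * enorm (submxrow (D k) i) ^+ 2.

Lemma pgradE k i : pgrad f i (ccd_point x k i) =
  (gamma k i)^-1 *: (beta k i *: submxrow (D k) i - submxrow (D k.+1) i).
Proof.
apply: (scalerI (lt0r_neq0 (gamma_gt0 k i))).
rewrite scalerA mulfV ?scale1r ?lt0r_neq0 ?gamma_gt0 //.
rewrite /D !submxrowB /= (x_scheme k i).
set A := submxrow (x k) i; set B := _ *: (A - _); set C := _ *: pgrad _ _ _.
by rewrite -(addrA A) (addrC A) addrK opprD opprK addrCA subrr addr0.
Qed.

(** The update rule makes the scalar product of the partial gradient with the
new increment a combination of |D_{k+1}|^2 and of <D_k, D_{k+1}>; the Young
inequality splits the latter evenly. What remains in front of |D_{k+1}|^2 is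
exactly -(delta_{k,i} + kappa_i), and delta_{k+1,i} <= delta_{k,i}. *)
Lemma block_step_decrease k i :
  dot (pgrad f i (ccd_point x k i)) (submxrow (D k.+1) i)
    + L i / 2 * enorm (submxrow (D k.+1) i) ^+ 2
  <= (delta L gamma beta k i - kappa i) * enorm (submxrow (D k) i) ^+ 2
   - (delta L gamma beta k.+1 i + kappa i) * enorm (submxrow (D k.+1) i) ^+ 2.
Proof.
rewrite pgradE dotZl dotDl dotNl dotZl -sqr_enorm.
have le_dot := dot_le_enorm (submxrow (D k) i) (submxrow (D k.+1) i).
set u := enorm (submxrow (D k) i) in le_dot *.
set v := enorm (submxrow (D k.+1) i) in le_dot *.
set d := dot _ _ in le_dot *.
have d_le : d <= (u ^+ 2 + v ^+ 2) / 2 by have := sqr_ge0 (u - v); nra.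
have dl_le := @delta_nincr k k.+1 i (leqnSn k).
have gb_ge0 : 0 <= beta k i / gamma k i.
  by case/andP: (beta_itv k i) => ? _; rewrite divr_ge0 // ltW ?gamma_gt0.
have dk := delta_kappa k i.
have kE : L i / (2 * c) = 2 * kappa i + L i / 2.
  by rewrite /kappa; case/andP: c_itv => ? _; field; lra.
have gE := gammaV_beta k i; rewrite kE mulrBl mul1r in gE.
have bd_le := ler_wpM2l gb_ge0 d_le.
have dv_le := ler_wpM2r (sqr_ge0 v) dl_le.
have -> : (gamma k i)^-1 * (beta k i * d - v ^+ 2)
    = beta k i / gamma k i * d - (gamma k i)^-1 * v ^+ 2 by ring.
rewrite dk in dv_le *; move: (beta k i / gamma k i) gE bd_le dv_le => b.
by move=> /(canRL (subrK _)) ->; lra.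
Qed.

Lemma lyapunov_decrease k :
  lyapunov k.+1 + \sum_(i < m.+1) kappa i *
    (enorm (submxrow (D k) i) ^+ 2 + enorm (submxrow (D k.+1) i) ^+ 2)
  <= lyapunov k.
Proof.
rewrite /lyapunov -addrA -big_split /=.
apply: le_trans (lerD (sweep_descent x f_diff f_lip k) (lexx _)) _.
rewrite -addrA lerD2l -big_split /=; apply: ler_sum => i _.
have := block_step_decrease k i; rewrite /D /=; lra.
Qed.

(** A lower bound of all kappa_i, so that the decrease is controlled by full
norms instead of block norms. *)
Definition kappa_min : R := Lmin L * (1 - c) / (4 * c).

Lemma kappa_min_gt0 : 0 < kappa_min.
Proof.
have /andP[c0 c1] := c_itv.
by rewrite divr_gt0 ?mulr_gt0 ?Lmin_gt0 // subr_gt0.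
Qed.

Lemma lyapunov_step k :
  kappa_min * (enorm (D k) ^+ 2 + enorm (D k.+1) ^+ 2)
  <= lyapunov k - lyapunov k.+1.
Proof.
rewrite lerBrDl; apply: le_trans _ (lyapunov_decrease k).
rewrite lerD2l !sqr_enorm !dot_blocks -big_split mulr_sumr /=.
apply: ler_sum => i _; rewrite -!sqr_enorm.
apply: ler_wpM2r; first by rewrite addr_ge0 ?sqr_ge0.
have /andP[c0 c1] := c_itv.
rewrite /kappa_min /kappa ler_pM2r ?invr_gt0 ?mulr_gt0 //.
by rewrite ler_pM2r ?subr_gt0 // Lmin_le.
Qed.

Lemma lyapunov_nincr k : lyapunov k <= lyapunov 0.
Proof.
elim: k => // k; apply: le_trans; rewrite -subr_ge0.
apply: le_trans _ (lyapunov_step k).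
by rewrite mulr_ge0 ?addr_ge0 ?sqr_ge0 // ltW // kappa_min_gt0.
Qed.

Lemma le_lyapunov k : f (x k) <= lyapunov k.
Proof.
by rewrite lerDl; apply: sumr_ge0 => i _; rewrite mulr_ge0 ?sqr_ge0 ?delta_ge0.
Qed.

(* 1 / gamma_{0,i} bounds 1 / gamma_{k,i} for all k. *)
Let G : R := \sum_(i < m.+1) ((gamma 0 i)^-1 + L i).

(** The i-th partial gradient at x^{k+1} differs from the one that the scheme
evaluates by at most L_i |D_{k+1}|, since the two points differ only in blocks
not yet updated. *)
Lemma pgrad_le k i : enorm (pgrad f i (x k.+1)) <=
  ((gamma 0 i)^-1 + L i) * (enorm (D k) + enorm (D k.+1)).
Proof.
have -> : pgrad f i (x k.+1) = pgrad f i (ccd_point x k i) +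
    (pgrad f i (x k.+1) - pgrad f i (ccd_point x k i)) by rewrite subrKC.
apply: le_trans (ler_enormD _ _) _.
rewrite mulrDl; apply: lerD; last first.
  apply: le_trans (f_lip _ _ _) _; rewrite ler_pM2l //.
  by rewrite (le_trans (ccd_point_dist _ _ _)) // lerDr enorm_ge0.
have g0 : 0 < (gamma k i)^-1 by rewrite invr_gt0 gamma_gt0.
rewrite pgradE enormZ (gtr0_norm g0).
apply: ler_pM; rewrite ?enorm_ge0 ?(ltW g0) //; first exact: gammaV_nincr.
apply: le_trans (ler_enormB _ _) _; apply: lerD; last exact: enorm_block.
have /andP[b0 b1] := beta_itv k i.
rewrite enormZ ger0_norm // -[leRHS]mul1r.
by apply: ler_pM; rewrite ?enorm_ge0 ?enorm_block // ltW.
Qed.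

Hypothesis f_convex : convex_function setT f.

Lemma gap_le k y : f (x k.+1) - f y <=
  G * (enorm (D k) + enorm (D k.+1)) * enorm (x k.+1 - y).
Proof.
have := @convex_grad _ _ f (x k.+1) y f_convex (f_diff _).
rewrite -opprB dotNr lerBlDr -lerBlDl => /le_trans; apply.
rewrite dot_blocks /G !mulr_suml; apply: ler_sum => i _.
apply: le_trans (dot_le_enorm _ _) _; apply: ler_pM; rewrite ?enorm_ge0 //.
  exact: pgrad_le.
exact: enorm_block.
Qed.

(** The kinetic part of the Lyapunov function is quadratic in D_{k+1}; bounding
one factor by r makes it linear, of the same order as the bound on the gap of
f. The weights satisfy delta_{k,i} <= 1 / gamma_{0,i} + L_i, so the same
constant serves for both. *)
Lemma lyapunov_gap_le (r : R) k y :
  enorm (D k.+1) <= r -> enorm (x k.+1 - y) <= r ->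
  lyapunov k.+1 - f y <= 2 * r * G * (enorm (D k) + enorm (D k.+1)).
Proof.
move=> Dr xyr; have r0 : 0 <= r := le_trans (enorm_ge0 _) Dr.
have G0 : 0 <= G.
  by apply: sumr_ge0 => i _; rewrite addr_ge0 // ltW ?invr_gt0 ?gamma_gt0.
have Hsum : \sum_(i < m.+1) delta L gamma beta k.+1 i
      * enorm (submxrow (D k.+1) i) ^+ 2 <= G * enorm (D k.+1) ^+ 2.
  rewrite mulr_suml; apply: ler_sum => i _.
  apply: ler_pM; rewrite ?sqr_ge0 ?delta_ge0 //; last first.
    by rewrite ler_pXn2r ?nnegrE ?enorm_ge0 // enorm_block.
  have := @delta_nincr 0 k.+1 i (leq0n _); rewrite (deltaE 0).
  have : 0 < (gamma 0 i)^-1 by rewrite invr_gt0 gamma_gt0.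
  have := L_gt0 i; lra.
have := gap_le k y; rewrite /lyapunov.
have := enorm_ge0 (D k); have := enorm_ge0 (D k.+1).
move: (enorm (D k.+1)) (enorm (D k)) Dr Hsum => v u vr Hsum v0 u0 gap.
have H1 : G * (u + v) * enorm (x k.+1 - y) <= G * (u + v) * r.
  by rewrite ler_wpM2l // mulr_ge0 // addr_ge0.
have H2 : G * v ^+ 2 <= G * (v * r).
  by rewrite ler_wpM2l // expr2 ler_wpM2l.
have H3 : 0 <= G * u * r by rewrite !mulr_ge0.
lra.
Qed.

Lemma lyapunov_rate (r : R) y : argmin f y ->
  (forall k, enorm (x k) <= r) -> enorm y <= r ->
  exists2 B : R, 0 < B & forall k, lyapunov k - f y <= B / k.+1%:R.
Proof.
move=> ymin xr yr.
pose M := 2 * (r + r) * G.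
(* The summand 1 keeps the constant positive when M = 0. *)
apply: (@sublinear_rate _ _ (2 * M ^+ 2 / kappa_min + 1)) => [|k|k].
- rewrite ltr_wpDl // divr_ge0 ?(ltW kappa_min_gt0) //.
  by rewrite mulr_ge0 ?sqr_ge0.
- by rewrite subr_ge0; exact: le_trans (ymin (x k)) (le_lyapunov k).
have Dr : enorm (D k.+1) <= r + r.
  exact: le_trans (ler_enormB _ _) (lerD (xr _) (xr _)).
have yrr : enorm (x k.+1 - y) <= r + r.
  exact: le_trans (ler_enormB _ _) (lerD (xr _) yr).
have gap := lyapunov_gap_le Dr yrr.
have gap0 : 0 <= lyapunov k.+1 - f y.
  by rewrite subr_ge0; exact: le_trans (ymin _) (le_lyapunov _).
have step := lyapunov_step k; have k0 := kappa_min_gt0.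
have -> : lyapunov k - f y - (lyapunov k.+1 - f y) = lyapunov k - lyapunov k.+1.
  by ring.
rewrite -/M in gap.
have sq : (lyapunov k.+1 - f y) ^+ 2
    <= (M * (enorm (D k) + enorm (D k.+1))) ^+ 2.
  by rewrite ler_pXn2r ?nnegrE //; exact: le_trans gap0 gap.
apply: (le_trans sq).
set E := enorm (D k) ^+ 2 + enorm (D k.+1) ^+ 2 in step.
have E0 : 0 <= E by rewrite addr_ge0 ?sqr_ge0.
have H1 : (M * (enorm (D k) + enorm (D k.+1))) ^+ 2 <= 2 * M ^+ 2 * E.
  have -> : 2 * M ^+ 2 * E = M ^+ 2 * (2 * E) by ring.
  rewrite exprMn ler_wpM2l ?sqr_ge0 // /E.
  have := sqr_ge0 (enorm (D k) - enorm (D k.+1)); nra.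
apply: (le_trans H1).
have H2 : 2 * M ^+ 2 * E = 2 * M ^+ 2 / kappa_min * (kappa_min * E).
  by field; lra.
rewrite H2 [leRHS]mulrDl mul1r -[leLHS]addr0; apply: lerD.
  by rewrite ler_wpM2l // divr_ge0 ?(ltW k0) // mulr_ge0 ?sqr_ge0.
by apply: le_trans step; rewrite mulr_ge0 // ltW.
Qed.

End heavy_ball.

(** * Finiteness of R *)

Section argmin_bounds.
Variables (R : realType) (n : nat) (f : 'rV[R]_n -> R).
Variables (x : nat -> 'rV[R]_n) (r : R).
Hypothesis x_le : forall k, enorm (x k) <= r.
Hypothesis argmin_le : forall y, argmin f y -> enorm y <= r.

Lemma argmin_dist_le k y : argmin f y -> enorm (x k - y) ^+ 2 <= (r + r) ^+ 2.
Proof.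
move=> /argmin_le yr; have r0 := le_trans (enorm_ge0 _) yr.
rewrite ler_pXn2r ?nnegrE ?enorm_ge0 ?addr_ge0 //.
exact: le_trans (ler_enormB _ _) (lerD (x_le k) yr).
Qed.

(** Both nested suprema are over nonempty sets bounded by (2 r)^2, hence genuine
upper bounds. *)
Lemma le_Rsup k y : argmin f y -> enorm (x k - y) ^+ 2 <= Rsup f x.
Proof.
move=> ymin; pose A j := [set enorm (x j - xs) ^+ 2 | xs in argmin f].
have ubA j : ubound (A j) ((r + r) ^+ 2).
  by move=> _ [z zmin <-]; exact: argmin_dist_le.
have A_y j : A j (enorm (x j - y) ^+ 2) by exists y.
apply: (@le_trans _ _ (sup (A k))).
  by apply: ub_le_sup (A_y k); exists ((r + r) ^+ 2).
apply: ub_le_sup; last by exists k.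
exists ((r + r) ^+ 2) => _ [j _ <-]; apply: ge_sup (ubA j).
by exists (enorm (x j - y) ^+ 2).
Qed.

End argmin_bounds.

(** * The rate of convergence *)

Theorem theorem3 (R : realType) (m : nat) (n : 'I_m.+1 -> nat)
  (f : 'rV[R]_(\sum_(i < m.+1) n i) -> R) (fmin : R)
  (L : 'I_m.+1 -> R) (c beta0 : R)
  (beta gamma : nat -> 'I_m.+1 -> R)
  (xm1 : 'rV[R]_(\sum_(i < m.+1) n i))
  (x : nat -> 'rV[R]_(\sum_(i < m.+1) n i))
  (f_convex : convex_function setT f)
  (f_diff : forall y, differentiable f y)
  (f_coercive : coercive f)
  (f_min : is_min f fmin)
  (L_gt0 : forall i, 0 < L i)
  (f_lip : forall i y z,
     enorm (pgrad f i y - pgrad f i z) <= L i * enorm (y - z))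
  (beta_itv : forall k i, 0 <= beta k i < 1)
  (beta_nincr : forall i, nonincreasing_seq (beta ^~ i))
  (beta_inf : forall i, 0 < inf (range (beta ^~ i)))
  (beta_inf_le : forall k i, inf (range (beta ^~ i)) <= beta k i)
  (beta_le : forall k i, beta k i <= beta0)
  (beta0_lt1 : beta0 < 1)
  (c_itv : 0 < c < 1)
  (gammaE : forall k i, gamma k i = 2 * (1 - beta k i) * c / L i)
  (x_scheme : ccd_heavy_ball f gamma beta xm1 x) :
  (fun k : nat => f (x k) - fmin : R^o) =O_\oo
  (fun k : nat =>
     4 * Rsup f x * sup (range (eps_hat L c gamma beta)) / k%:R : R^o).
Proof.
have [y ymin fy] := f_min.
pose xi := lyapunov f L beta gamma xm1 x.
have f_le k : f (x k) <= xi 0%N.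
  have := lyapunov_nincr L_gt0 beta_itv beta_nincr c_itv gammaE f_diff f_lip
    x_scheme k.
  exact: le_trans (le_lyapunov f xm1 x L_gt0 beta_itv c_itv gammaE k).
have [r0 r0P] := f_coercive (xi 0%N).
have lvl z : f z <= xi 0%N -> enorm z <= r0.
  by move=> fz; rewrite leNgt; apply/negP => /r0P; rewrite ltNge fz.
have x_le k : enorm (x k) <= r0 by exact/lvl/f_le.
have argmin_le z : argmin f z -> enorm z <= r0.
  by move=> zmin; apply: lvl; exact: le_trans (zmin _) (f_le 0%N).
have le_R k := le_Rsup x_le argmin_le k ymin.
have [B B_gt0 rate] : exists2 B : R, 0 < B &
    forall k, f (x k) - fmin <= B / k.+1%:R.
  have [B B_gt0 BP] := lyapunov_rate L_gt0 beta_itv beta_nincr c_itv gammaE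
    f_diff f_lip x_scheme f_convex ymin x_le (argmin_le _ ymin).
  exists B => // k; apply: le_trans (BP k); rewrite -fy lerB //.
  exact: (le_lyapunov f xm1 x L_gt0 beta_itv c_itv gammaE).
have gap_ge0 k : 0 <= f (x k) - fmin by rewrite -fy subr_ge0; exact: ymin.
have eps_gt0 := sup_eps_hat_gt0 L_gt0 beta_itv beta_nincr c_itv gammaE.
(* If R = 0, every iterate coincides with the minimizer y. *)
apply/eqO_exP; have [R_le0|R_gt0] := leP (Rsup f x) 0.
  exists 1 => //; near=> k; rewrite mul1r.
  suff -> : x k = y by rewrite fy subrr normr0.
  apply/eqP; rewrite -subr_eq0; apply/eqP/enorm_eq0/eqP.
  by rewrite -sqrf_eq0 eq_le sqr_ge0 (le_trans (le_R k)).
have RE_gt0 : 0 < 4 * Rsup f x * sup (range (eps_hat L c gamma beta)).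
  by rewrite !mulr_gt0.
set RE := _ * sup _ in RE_gt0 *.
exists (B / RE); first by rewrite /= divr_gt0.
near=> k.
have k_gt0 : 0 < k%:R :> R by rewrite ltr0n; near: k; exact: nbhs_infty_gt.
rewrite ger0_norm // gtr0_norm ?divr_gt0 //.
have -> : B / RE * (RE / k%:R) = B / k%:R by field; rewrite !gt_eqF.
apply: le_trans (rate k) _.
rewrite ler_pM2l // lef_pV2 ?posrE ?ltr0Sn // -natr1.
by rewrite lerDl.
Unshelve. all: by end_near. Qed.
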